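(* Let $\gamma=0$ and assume that the eigenvalues of $A$ can be anywhere in the interval $[0,\infty)$. Then the optimal relaxation parameter of the Dirichlet-Neumann algorithm DN$_2$, i.e. the minimizer $\theta^\star_{\mathrm{DN}_2}$ over $\theta\in(0,1)$ of $\sup_{d\in[0,\infty)}|r(\theta,d)|$, is $$\theta^\star_{\mathrm{DN}_2}=\frac{2}{3+\coth\big(\sqrt{\nu^{-1}}\,\alpha\big)\coth\big(\sqrt{\nu^{-1}}\,(T-\alpha)\big)},$$ and it satisfies $\theta^\star_{\mathrm{DN}_2}<\frac12$.
   Context: Let $\nu>0$, $T>0$, $0<\alpha<T$, $\Omega_1=(0,\alpha)$, $\Omega_2=(\alpha,T)$. Algorithm DN$_2$ (error equations) for an eigenvalue $d\ge0$, with $\gamma=0$: given $f^0\in\mathbb{R}$, for $k=1,2,\dots$: (1) solve $\dot z_1^k+dz_1^k-\nu^{-1}\mu_1^k=0$, $\dot\mu_1^k-z_1^k-d\mu_1^k=0$ in $\Omega_1$ with $z_1^k(0)=0$, $z_1^k(\alpha)=f^{k-1}$; (2) solve $\dot z_2^k+dz_2^k-\nu^{-1}\mu_2^k=0$, $\dot\mu_2^k-z_2^k-d\mu_2^k=0$ in $\Omega_2$ with $\dot z_2^k(\alpha)=\dot z_1^k(\alpha)$, $\mu_2^k(T)=0$; (3) set $f^k=(1-\theta)f^{k-1}+\theta z_2^k(\alpha)$. Since the problem is linear, $f^k=r(\theta,d)f^{k-1}$ for a real number $r(\theta,d)$ depending only on $\theta,d,\nu,T,\alpha$; $|r(\theta,d)|$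 is the convergence factor for the eigenvalue $d$. *)

(* Defs.v *)
From Stdlib Require Import Reals.
From Coquelicot Require Import Coquelicot.
Open Scope R_scope.

Definition coth (x : R) : R := cosh x / sinh x.

(* Classical solution: continuous on [a, b], differentiable in ]a, b[.  The
   functions are total, but their values outside [a, b] play no role. *)
Definition solves_on (nu d a b : R) (z mu : R -> R) : Prop :=
  continuous_on (fun t => a <= t <= b) z /\
  continuous_on (fun t => a <= t <= b) mu /\
  forall t, a < t < b ->
    ex_derive z t /\ ex_derive mu t /\
    Derive z t + d * z t - / nu * mu t = 0 /\
    Derive mu t - z t - d * mu t = 0.

Definition is_left_derive (f : R -> R) (x l : R) : Prop :=
  filterlim (fun t => (f t - f x) / (t - x)) (at_left x) (locally l).

Definition is_right_derive (f : R -> R) (x l : R) : Prop :=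
  filterlim (fun t => (f t - f x) / (t - x)) (at_right x) (locally l).

Definition DN2_step (nu T alpha theta d f g : R) : Prop :=
  exists z1 mu1 z2 mu2 : R -> R,
    (solves_on nu d 0 alpha z1 mu1 /\ z1 0 = 0 /\ z1 alpha = f) /\
    (solves_on nu d alpha T z2 mu2 /\
     (exists l, is_left_derive z1 alpha l /\ is_right_derive z2 alpha l) /\
     mu2 T = 0) /\
    g = (1 - theta) * f + theta * z2 alpha.

Definition DN2_run (nu T alpha theta d : R) (f : nat -> R) : Prop :=
  forall k, DN2_step nu T alpha theta d (f k) (f (S k)).

(* [iota] selects the unique real with the given property.  Uniqueness forces
   runs with a nonzero iterate to exist: otherwise every rho would qualify. *)
Definition DN2_ratio (nu T alpha theta d : R) : R :=
  iota (fun rho : R =>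
    forall f, DN2_run nu T alpha theta d f -> forall k, f (S k) = rho * f k).

Definition DN2_worst_factor (nu T alpha theta : R) : Rbar :=
  Lub_Rbar (fun y =>
    exists d, 0 <= d /\ y = Rabs (DN2_ratio nu T alpha theta d)).

Definition DN2_optimal (nu T alpha theta : R) : Prop :=
  0 < theta < 1 /\
  forall theta', 0 < theta' < 1 ->
    Rbar_le (DN2_worst_factor nu T alpha theta)
            (DN2_worst_factor nu T alpha theta').

(* Main.v *)
(** For every [d] the coupled system is [(z, mu)' = M (z, mu)] with
    [M = [[- d, 1 / nu], [1, d]]] and [M ^ 2 = s ^ 2 I], where
    [s = sqrt (d ^ 2 + 1 / nu)], so its flow is
    [cosh (s t) I + sinh (s t) / s M] and both subdomain problems are explicit.
    With [a = alpha] and [b = T - alpha] this gives [r = 1 - theta (1 + G d)],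
    [G d = coth (s a) (s coth (s b) + d) / (s + d coth (s b))].  One has
    [1 <= G d <= coth (s a) coth (s b)]: the upper bound is attained at [d = 0],
    decreases in [d], and tends to [1].  Hence the supremum of [|r|] is
    [max |1 - 2 theta| |1 - theta (1 + G 0)|], which is minimal exactly when
    [1 - 2 theta = theta (1 + G 0) - 1]. *)

Require Import Defs.
From Stdlib Require Import Reals Lra.
From Coquelicot Require Import Coquelicot.
Open Scope R_scope.

(** * Hyperbolic functions *)

Lemma cosh_opp (x : R) : cosh (- x) = cosh x.
Proof. unfold cosh. rewrite Ropp_involutive. field. Qed.

Lemma sinh_opp (x : R) : sinh (- x) = - sinh x.
Proof. unfold sinh. rewrite Ropp_involutive. field. Qed.

Lemma cosh_gt_0 (x : R) : 0 < cosh x.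
Proof.
  unfold cosh. generalize (exp_pos x) (exp_pos (- x)). lra.
Qed.

Lemma sinh_gt_0 (x : R) : 0 < x -> 0 < sinh x.
Proof.
  intros Hx. unfold sinh.
  assert (exp (- x) < exp x) by (apply exp_increasing; lra). lra.
Qed.

(** In this form the only dependence on [x] is through [exp (2 * x)], so the monotonicity and the
    two bounds below reduce to facts about the exponential. *)
Lemma coth_exp (x : R) : 0 < x -> coth x = 1 + 2 / (exp (2 * x) - 1).
Proof.
  intros Hx. unfold coth, cosh, sinh.
  assert (He : 1 < exp x) by (rewrite <- exp_0; apply exp_increasing; lra).
  replace (2 * x) with (x + x) by ring.
  rewrite exp_plus, exp_Ropp. field. repeat split; nra.
Qed.

Lemma coth_decreasing (x y : R) : 0 < x -> x <= y -> coth y <= coth x.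
Proof.
  intros Hx Hxy. rewrite !coth_exp by lra.
  assert (1 < exp (2 * x)) by (rewrite <- exp_0; apply exp_increasing; lra).
  assert (exp (2 * x) <= exp (2 * y)).
  { destruct Hxy as [H'| ->]; [left; apply exp_increasing|]; lra. }
  apply Rplus_le_compat_l, Rmult_le_compat_l; [lra|].
  apply Rinv_le_contravar; lra.
Qed.

Lemma coth_gt_1 (x : R) : 0 < x -> 1 < coth x.
Proof.
  intros Hx. rewrite coth_exp by lra.
  assert (1 < exp (2 * x)) by (rewrite <- exp_0; apply exp_increasing; lra).
  assert (0 < 2 / (exp (2 * x) - 1)) by (apply Rdiv_lt_0_compat; lra). lra.
Qed.

(** Follows from [1 + 2 * x < exp (2 * x)]. It gives an explicit rate for the convergence of [coth]
    to 1, from which [gain_inf] builds its witness. *)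
Lemma coth_le (x : R) : 0 < x -> coth x <= 1 + / x.
Proof.
  intros Hx. rewrite coth_exp by lra.
  assert (1 + 2 * x < exp (2 * x)) by (apply exp_ineq1; lra).
  apply Rplus_le_compat_l.
  replace (/ x) with (2 / (2 * x)) by (field; lra).
  apply Rmult_le_compat_l; [lra|]. apply Rinv_le_contravar; lra.
Qed.

(** * Continuity and constancy on a closed segment *)

Lemma continuous_on_mult (D : R -> Prop) (f g : R -> R) :
  continuous_on D f -> continuous_on D g ->
  continuous_on D (fun t => f t * g t).
Proof.
  intros Hf Hg x Dx.
  eapply filterlim_comp_2;
    [apply Hf, Dx | apply Hg, Dx | apply (filterlim_mult (f x) (g x))].
Qed.

Lemma continuous_on_plus (D : R -> Prop) (f g : R -> R) :
  continuous_on D f -> continuous_on D g ->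
  continuous_on D (fun t => f t + g t).
Proof.
  intros Hf Hg x Dx.
  eapply filterlim_comp_2;
    [apply Hf, Dx | apply Hg, Dx | apply (filterlim_plus (f x) (g x))].
Qed.

Lemma continuous_continuous_on_R (D : R -> Prop) (f : R -> R) :
  (forall t, continuous f t) -> continuous_on D f.
Proof.
  intros Hf x _ P HP. specialize (Hf x P HP).
  unfold filtermap, within in *. revert Hf. apply filter_imp. auto.
Qed.

(** Clamping the argument is 1-Lipschitz and lands in the segment. It thus extends a function known
    only on [[a, b]] to one continuous on the whole line, as the mean value theorem demands at the
    endpoints. *)
Lemma continuous_clamp (f : R -> R) (a b : R) :
  a <= b -> continuous_on (fun t => a <= t <= b) f ->
  forall x, continuous (fun t => f (Rmax a (Rmin b t))) x.
Proof.
  intros Hab Hf x.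
  assert (Hin : forall t, a <= Rmax a (Rmin b t) <= b).
  { intros t. split; [apply Rmax_l|]. apply Rmax_lub; [lra|apply Rmin_l]. }
  apply (filterlim_comp _ _ _ (fun t => Rmax a (Rmin b t)) f _
    (within (fun t => a <= t <= b) (locally (Rmax a (Rmin b x))))).
  - intros P [eps HP]. exists eps. intros y Hy. apply HP; [|apply Hin].
    apply Rle_lt_trans with (2 := Hy).
    change (Rabs (Rmax a (Rmin b y) - Rmax a (Rmin b x)) <= Rabs (y - x)).
    unfold Rmax, Rmin, Rabs.
    repeat (destruct Rle_dec || destruct Rcase_abs); lra.
  - apply Hf, Hin.
Qed.

Lemma constant_on_segment (f : R -> R) (a b x y : R) :
  a <= x <= b -> a <= y <= b ->
  continuous_on (fun t => a <= t <= b) f ->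
  (forall t, a < t < b -> is_derive f t 0) -> f x = f y.
Proof.
  assert (Hlt : forall x y, a <= x -> x < y -> y <= b ->
    continuous_on (fun t => a <= t <= b) f ->
    (forall t, a < t < b -> is_derive f t 0) -> f x = f y).
  { clear x y. intros x y Hx Hxy Hy Hc Hd.
    assert (Hab : a <= b) by lra.
    set (g := fun t => f (Rmax a (Rmin b t))).
    assert (Hg : forall t, a <= t <= b -> g t = f t).
    { intros t Ht. unfold g. rewrite Rmin_right, Rmax_right; lra. }
    destruct (MVT_gen g x y (fun _ => 0)) as [c [_ Hc']].
    - intros t. rewrite Rmin_left, Rmax_right by lra. intros Ht.
      apply is_derive_ext_loc with f; [|apply Hd; lra].
      apply (locally_interval _ t a b); [simpl; lra..|].
      simpl. intros u Hu1 Hu2. symmetry. apply Hg. lra.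
    - intros t _. apply continuity_pt_filterlim. apply continuous_clamp; auto.
    - rewrite !Hg in Hc' by lra. lra. }
  intros Hx Hy Hc Hd.
  destruct (Rtotal_order x y) as [H|[->|H]]; [|reflexivity|symmetry];
    apply Hlt; auto; lra.
Qed.

(** * The flow of the coupled system *)

Definition sigma (nu d : R) : R := sqrt (d * d + / nu).

(** First component at time [t] of the solution passing through [(z0, m0)] at time [s]; the rate is
    [sigma nu d], and [s] is the base time. *)
Definition flow_z (nu d s z0 m0 t : R) : R :=
  cosh (sigma nu d * (t - s)) * z0
  + sinh (sigma nu d * (t - s)) / sigma nu d * (/ nu * m0 - d * z0).

Definition flow_mu (nu d s z0 m0 t : R) : R :=
  cosh (sigma nu d * (t - s)) * m0
  + sinh (sigma nu d * (t - s)) / sigma nu d * (z0 + d * m0).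

Lemma sigma_gt_0 (nu d : R) : 0 < nu -> 0 < sigma nu d.
Proof.
  intros Hnu. apply sqrt_lt_R0. assert (0 < / nu) by now apply Rinv_0_lt_compat.
  nra.
Qed.

Lemma sigma_sqr (nu d : R) : 0 < nu -> sigma nu d * sigma nu d = d * d + / nu.
Proof.
  intros Hnu. apply sqrt_sqrt. assert (0 < / nu) by now apply Rinv_0_lt_compat.
  nra.
Qed.

Lemma is_derive_flow_z (nu d s z0 m0 t : R) : 0 < nu ->
  is_derive (flow_z nu d s z0 m0) t
    (sigma nu d * sinh (sigma nu d * (t - s)) * z0
     + cosh (sigma nu d * (t - s)) * (/ nu * m0 - d * z0)).
Proof.
  intros Hnu. unfold flow_z. pose proof (sigma_gt_0 nu d Hnu).
  auto_derive; [lra|]. unfold Rminus. field. lra.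
Qed.

Lemma is_derive_flow_mu (nu d s z0 m0 t : R) : 0 < nu ->
  is_derive (flow_mu nu d s z0 m0) t
    (sigma nu d * sinh (sigma nu d * (t - s)) * m0
     + cosh (sigma nu d * (t - s)) * (z0 + d * m0)).
Proof.
  intros Hnu. unfold flow_mu. pose proof (sigma_gt_0 nu d Hnu).
  auto_derive; [lra|]. unfold Rminus. field. lra.
Qed.

Lemma flow_solves (nu d s z0 m0 a b : R) : 0 < nu ->
  solves_on nu d a b (flow_z nu d s z0 m0) (flow_mu nu d s z0 m0).
Proof.
  intros Hnu. pose proof (sigma_gt_0 nu d Hnu) as Hs.
  pose proof (sigma_sqr nu d Hnu) as Hss.
  split; [|split].
  - apply continuous_continuous_on_R. intros t.
    apply (ex_derive_continuous (flow_z nu d s z0 m0)).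
    eexists. now apply is_derive_flow_z.
  - apply continuous_continuous_on_R. intros t.
    apply (ex_derive_continuous (flow_mu nu d s z0 m0)).
    eexists. now apply is_derive_flow_mu.
  - intros t _.
    split; [eexists; now apply is_derive_flow_z|].
    split; [eexists; now apply is_derive_flow_mu|].
    rewrite (is_derive_unique _ _ _ (is_derive_flow_z nu d s z0 m0 t Hnu)).
    rewrite (is_derive_unique _ _ _ (is_derive_flow_mu nu d s z0 m0 t Hnu)).
    unfold flow_z, flow_mu.
    generalize (sinh (sigma nu d * (t - s))) (cosh (sigma nu d * (t - s))).
    intros S C.
    (* Replacing one [sigma] by [sigma ^ 2 / sigma] brings in the relation [M ^ 2 = sigma ^ 2 I];
       what remains is a rational identity. *)
    assert (Hss' : sigma nu d = (d * d + / nu) / sigma nu d)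
      by (rewrite <- Hss; field; lra).
    split.
    + rewrite Hss' at 1. field. lra.
    + rewrite Hss' at 1. field. lra.
Qed.

(* Transporting the state at time [t] to a fixed time by the flow gives a
   quantity independent of [t]. *)
Lemma solves_on_flow (nu d a b s t : R) (z mu : R -> R) : 0 < nu ->
  solves_on nu d a b z mu -> a <= s <= b -> a <= t <= b ->
  z t = flow_z nu d s (z s) (mu s) t.
Proof.
  intros Hnu (Hz & Hmu & Hd) Hs Ht.
  pose proof (sigma_gt_0 nu d Hnu) as Hs0.
  pose proof (sigma_sqr nu d Hnu) as Hss.
  (* Transport over zero time is the identity, so [z t] is the value at [u = t] of the conserved
     quantity, whose value at [u = s] is the right-hand side. *)
  assert (Hend : z t = flow_z nu d t (z t) (mu t) t).
  { unfold flow_z. rewrite Rminus_diag, Rmult_0_r, cosh_0, sinh_0.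
    field. split; lra. }
  rewrite Hend at 1.
  apply (constant_on_segment (fun u => flow_z nu d u (z u) (mu u) t) a b);
    auto; unfold flow_z.
  - assert (Hu : forall u, continuous (fun u => sigma nu d * (t - u)) u).
    { intros u. apply (ex_derive_continuous (fun u => sigma nu d * (t - u))).
      auto_derive. auto. }
    assert (Hch : forall u, continuous (fun u => cosh (sigma nu d * (t - u))) u).
    { intros u.
      apply (ex_derive_continuous (fun u => cosh (sigma nu d * (t - u)))).
      auto_derive. auto. }
    assert (Hsh : forall u,
      continuous (fun u => sinh (sigma nu d * (t - u)) / sigma nu d) u).
    { intros u.
      apply (ex_derive_continuous
               (fun u => sinh (sigma nu d * (t - u)) / sigma nu d)).
      auto_derive. lra. }
    unfold Rminus at 3.
    apply continuous_on_plus; apply continuous_on_mult; auto;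
      try (now apply continuous_continuous_on_R).
    apply (continuous_on_plus _ (fun u => / nu * mu u) (fun u => - (d * z u))).
    + apply (continuous_on_mult _ (fun _ => / nu)); auto.
      apply continuous_continuous_on_R. intros u. apply continuous_const.
    + intros x Dx.
      apply (filterlim_comp _ _ _ (fun u => d * z u) Ropp _ (locally (d * z x))).
      * apply (continuous_on_mult _ (fun _ => d)); auto.
        apply continuous_continuous_on_R. intros u. apply continuous_const.
      * apply (filterlim_opp (d * z x)).
  - intros u Hu. destruct (Hd u Hu) as (Ez & Em & E1 & E2).
    auto_derive; [tauto|].
    assert (Dz : Derive (fun x => z x) u = / nu * mu u - d * z u)
      by (change (Derive (fun x => z x) u) with (Derive z u); lra).
    assert (Dm : Derive (fun x => mu x) u = z u + d * mu u)
      by (change (Derive (fun x => mu x) u) with (Derive mu u); lra).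
    rewrite Dz, Dm.
    generalize (sinh (sigma nu d * (t + - u))) (cosh (sigma nu d * (t + - u))).
    intros S C.
    replace (sigma nu d * - (1) * S) with (- ((d * d + / nu) / sigma nu d) * S)
      by (rewrite <- Hss; field; lra).
    field. lra.
Qed.

(** * One-sided derivatives *)

Lemma is_derive_slope (f : R -> R) (x l : R) :
  is_derive f x l ->
  filterlim (fun t => (f t - f x) / (t - x)) (locally' x) (locally l).
Proof.
  intros Hf. apply is_derive_Reals in Hf. apply filterlim_locally. intros eps.
  destruct (Hf eps (cond_pos eps)) as [delta Hdelta].
  exists delta. intros t Ht Hne. change R in t.
  specialize (Hdelta (t - x)). replace (x + (t - x)) with t in Hdelta by ring.
  apply Hdelta; [lra|exact Ht].
Qed.

(** Left slopes at [b] see only values in [[a, b]]. Hence a subdomain solution inherits its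
    derivative at the interface from the explicit flow it agrees with there. *)
Lemma is_left_derive_on (f g : R -> R) (a b l : R) :
  a < b -> (forall t, a <= t <= b -> f t = g t) -> is_derive g b l ->
  is_left_derive f b l.
Proof.
  intros Hab Hfg Hg. unfold is_left_derive.
  apply filterlim_ext_loc with (fun t => (g t - g b) / (t - b)).
  - assert (He : 0 < b - a) by lra. exists (mkposreal _ He).
    intros t Ht Htb.
    change (Rabs (t - b) < b - a) in Ht. apply Rabs_def2 in Ht.
    rewrite !Hfg by lra. reflexivity.
  - apply filterlim_filter_le_1 with (2 := is_derive_slope g b l Hg).
    intros P. unfold locally', at_left, within.
    apply filter_imp. intros t HP Ht. apply HP. lra.
Qed.

Lemma is_right_derive_on (f g : R -> R) (a b l : R) :
  a < b -> (forall t, a <= t <= b -> f t = g t) -> is_derive g a l ->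
  is_right_derive f a l.
Proof.
  intros Hab Hfg Hg. unfold is_right_derive.
  apply filterlim_ext_loc with (fun t => (g t - g a) / (t - a)).
  - assert (He : 0 < b - a) by lra. exists (mkposreal _ He).
    intros t Ht Htb.
    change (Rabs (t - a) < b - a) in Ht. apply Rabs_def2 in Ht.
    rewrite !Hfg by lra. reflexivity.
  - apply filterlim_filter_le_1 with (2 := is_derive_slope g a l Hg).
    intros P. unfold locally', at_right, within.
    apply filter_imp. intros t HP Ht. apply HP. lra.
Qed.

(** * Explicit solution of one iteration *)

(* [z2 alpha = - gain * f] for the subdomain lengths [a = alpha] and
   [b = T - alpha]. *)
Definition gain (nu d a b : R) : R :=
  coth (sigma nu d * a)
  * ((sigma nu d * coth (sigma nu d * b) + d)
     / (sigma nu d + d * coth (sigma nu d * b))).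

(** Clears the inner [coth] and collects the positivity of every denominator met when solving the
    two subproblems. *)
Lemma gain_sinh_cosh (nu T alpha d : R) :
  0 < nu -> 0 < alpha < T -> 0 <= d ->
  let sg := sigma nu d in
  let Sb := sinh (sg * (T - alpha)) in
  let Cb := cosh (sg * (T - alpha)) in
  gain nu d alpha (T - alpha)
  = cosh (sg * alpha) / sinh (sg * alpha)
    * ((sg * Cb + d * Sb) / (sg * Sb + d * Cb))
  /\ 0 < Sb /\ 0 < Cb /\ 0 < sinh (sg * alpha) /\ 0 < sg
  /\ 0 < sg * Sb + d * Cb.
Proof.
  intros Hnu Halpha Hd sg Sb Cb.
  assert (Hs : 0 < sg) by now apply sigma_gt_0.
  assert (HSb : 0 < Sb) by (apply sinh_gt_0, Rmult_lt_0_compat; lra).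
  assert (HCb : 0 < Cb) by apply cosh_gt_0.
  assert (HSa : 0 < sinh (sg * alpha)) by (apply sinh_gt_0, Rmult_lt_0_compat; lra).
  assert (HD : 0 < sg * Sb + d * Cb) by nra.
  repeat split; auto.
  unfold gain, coth. fold sg. fold Sb Cb. field. repeat split; lra.
Qed.

Lemma DN2_step_exists (nu T alpha theta d f : R) :
  0 < nu -> 0 < alpha < T -> 0 <= d ->
  DN2_step nu T alpha theta d f
    ((1 - theta * (1 + gain nu d alpha (T - alpha))) * f).
Proof.
  intros Hnu Halpha Hd.
  destruct (gain_sinh_cosh nu T alpha d Hnu Halpha Hd)
    as (Hg & HSb & HCb & HSa & Hs & HD).
  set (sg := sigma nu d) in *.
  set (Sb := sinh (sg * (T - alpha))) in *.
  set (Cb := cosh (sg * (T - alpha))) in *.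
  (* [m0] is the initial [mu1] for which [z1 alpha = f], [l] is the resulting derivative of [z1] at
     [alpha], and [zT] is the final value of [z2] for which its derivative at [alpha] is also [l].
     The second flow is based at [T], where [mu2] vanishes. *)
  set (m0 := nu * f * sg / sinh (sg * alpha)).
  set (l := f * sg * cosh (sg * alpha) / sinh (sg * alpha)).
  set (zT := - l / (sg * Sb + d * Cb)).
  exists (flow_z nu d 0 0 m0), (flow_mu nu d 0 0 m0),
    (flow_z nu d T zT 0), (flow_mu nu d T zT 0).
  assert (HTa : sg * (alpha - T) = - (sg * (T - alpha))) by ring.
  split; [|split].
  - split; [now apply flow_solves|]. unfold flow_z. fold sg.
    rewrite !Rminus_0_r, (Rmult_0_r sg), sinh_0.
    split; [field; lra|]. unfold m0. field. repeat split; lra.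
  - split; [now apply flow_solves|]. split.
    + exists l. split.
      * apply (is_left_derive_on _ (flow_z nu d 0 0 m0) 0); [lra|auto|].
        replace l with (sg * sinh (sg * (alpha - 0)) * 0
          + cosh (sg * (alpha - 0)) * (/ nu * m0 - d * 0)).
        { now apply is_derive_flow_z. }
        rewrite Rminus_0_r. unfold m0, l. field. split; lra.
      * apply (is_right_derive_on _ (flow_z nu d T zT 0) alpha T); [lra|auto|].
        replace l with (sg * sinh (sg * (alpha - T)) * zT
          + cosh (sg * (alpha - T)) * (/ nu * 0 - d * zT)).
        { now apply is_derive_flow_z. }
        rewrite HTa, sinh_opp, cosh_opp. fold Sb Cb. unfold zT. field. lra.
    + unfold flow_mu. fold sg. rewrite Rminus_diag, (Rmult_0_r sg), sinh_0. field. lra.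
  - unfold flow_z. fold sg. rewrite HTa, sinh_opp, cosh_opp. fold Sb Cb.
    rewrite Hg. unfold zT, l. field. repeat split; lra.
Qed.

(** The outer boundary conditions leave one free parameter per subdomain, [mu1 0] and [z2 T]. The
    interface conditions relate both to [f], and eliminating them gives [g]. *)
Lemma DN2_step_unique (nu T alpha theta d f g : R) :
  0 < nu -> 0 < alpha < T -> 0 <= d ->
  DN2_step nu T alpha theta d f g ->
  g = (1 - theta * (1 + gain nu d alpha (T - alpha))) * f.
Proof.
  intros Hnu Halpha Hd.
  intros (z1 & mu1 & z2 & mu2 & (S1 & Z0 & Za) & (S2 & (l & L1 & L2) & MT) & ->).
  destruct (gain_sinh_cosh nu T alpha d Hnu Halpha Hd)
    as (Hg & HSb & HCb & HSa & Hs & HD).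
  set (sg := sigma nu d) in *.
  set (Sb := sinh (sg * (T - alpha))) in *.
  set (Cb := cosh (sg * (T - alpha))) in *.
  assert (HTa : sg * (alpha - T) = - (sg * (T - alpha))) by ring.
  assert (E1 : forall t, 0 <= t <= alpha -> z1 t = flow_z nu d 0 0 (mu1 0) t).
  { intros t Ht. rewrite (solves_on_flow nu d 0 alpha 0 t z1 mu1), Z0; auto; lra. }
  assert (E2 : forall t, alpha <= t <= T -> z2 t = flow_z nu d T (z2 T) 0 t).
  { intros t Ht.
    rewrite (solves_on_flow nu d alpha T T t z2 mu2), MT; auto; lra. }
  (* Limits being unique, [l] equals the derivative at [alpha] of each explicit flow; [Hl2] does the
     same from the right. *)
  assert (Hl1 : l = cosh (sg * alpha) * (/ nu * mu1 0)).
  { apply (filterlim_locally_unique _ _ _ L1).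
    apply (is_left_derive_on _ (flow_z nu d 0 0 (mu1 0)) 0); [lra|auto|].
    replace (cosh (sg * alpha) * (/ nu * mu1 0))
      with (sg * sinh (sg * (alpha - 0)) * 0
        + cosh (sg * (alpha - 0)) * (/ nu * mu1 0 - d * 0)).
    { now apply is_derive_flow_z. }
    rewrite Rminus_0_r. ring. }
  assert (Hl2 : l = - (sg * Sb + d * Cb) * z2 T).
  { apply (filterlim_locally_unique _ _ _ L2).
    apply (is_right_derive_on _ (flow_z nu d T (z2 T) 0) alpha T); [lra|auto|].
    replace (- (sg * Sb + d * Cb) * z2 T)
      with (sg * sinh (sg * (alpha - T)) * z2 T
        + cosh (sg * (alpha - T)) * (/ nu * 0 - d * z2 T)).
    { now apply is_derive_flow_z. }
    rewrite HTa, sinh_opp, cosh_opp. fold Sb Cb. ring. }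
  rewrite E1 in Za by lra. rewrite E2 by lra.
  unfold flow_z in *. fold sg in Za. fold sg.
  rewrite Rminus_0_r in Za. rewrite HTa, sinh_opp, cosh_opp. fold Sb Cb.
  rewrite Hg. rewrite <- Za.
  replace (z2 T) with (- l / (sg * Sb + d * Cb)) by (rewrite Hl2; field; lra).
  rewrite Hl1. field. repeat split; lra.
Qed.

Lemma DN2_ratio_gain (nu T alpha theta d : R) :
  0 < nu -> 0 < alpha < T -> 0 <= d ->
  DN2_ratio nu T alpha theta d = 1 - theta * (1 + gain nu d alpha (T - alpha)).
Proof.
  intros Hnu Halpha Hd. set (r := 1 - theta * (1 + gain nu d alpha (T - alpha))).
  apply (iota_unique (V := R_CompleteNormedModule)).
  - intros rho Hrho.
    (* The geometric run starts at 1, so its first step forces [rho = r]. *)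
    specialize (Hrho (fun k => r ^ k)).
    assert (Hrun : DN2_run nu T alpha theta d (fun k => r ^ k))
      by (intros k; now apply DN2_step_exists).
    specialize (Hrho Hrun 0%nat). simpl in Hrho. lra.
  - intros f Hf k. apply DN2_step_unique; auto.
Qed.

(** * Range of the gain over the spectrum *)

Lemma sigma_ge (nu d : R) : 0 < nu -> 0 <= d -> d <= sigma nu d.
Proof.
  intros Hnu Hd. pose proof (sigma_gt_0 nu d Hnu).
  pose proof (sigma_sqr nu d Hnu). assert (0 < / nu) by now apply Rinv_0_lt_compat.
  nra.
Qed.

Lemma sigma_0 (nu : R) : sigma nu 0 = sqrt (/ nu).
Proof. unfold sigma. f_equal. ring. Qed.

Lemma sigma_increasing (nu d : R) : 0 < nu -> sigma nu 0 <= sigma nu d.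
Proof.
  intros Hnu. apply sqrt_le_1_alt. nra.
Qed.

Lemma gain_0 (nu a b : R) : 0 < nu ->
  gain nu 0 a b = coth (sqrt (/ nu) * a) * coth (sqrt (/ nu) * b).
Proof.
  intros Hnu. pose proof (sigma_gt_0 nu 0 Hnu). rewrite <- sigma_0.
  unfold gain. field. lra.
Qed.

(** With [B = coth (sigma * b)], numerator minus denominator of the fraction is
    [(sigma - d) * (B - 1)], which is nonnegative since [d <= sigma] and [1 < B]. *)
Lemma gain_ge_1 (nu d a b : R) : 0 < nu -> 0 < a -> 0 < b -> 0 <= d ->
  1 <= gain nu d a b.
Proof.
  intros Hnu Ha Hb Hd. unfold gain.
  pose proof (sigma_gt_0 nu d Hnu). pose proof (sigma_ge nu d Hnu Hd).
  assert (H1 : 1 < coth (sigma nu d * a)) by (apply coth_gt_1; nra).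
  assert (H2 : 1 < coth (sigma nu d * b)) by (apply coth_gt_1; nra).
  revert H1 H2. generalize (coth (sigma nu d * a)) (coth (sigma nu d * b)).
  intros A B H1 H2.
  assert (HD : 0 < sigma nu d + d * B) by nra.
  assert (1 <= (sigma nu d * B + d) / (sigma nu d + d * B)).
  { apply Rle_div_r; nra. }
  nra.
Qed.

(** The fraction is at most [B = coth (sigma * b)], because [sigma * B + d <= B * (sigma + d * B)]
    amounts to [d <= d * B ^ 2]. *)
Lemma gain_le_coth (nu d a b : R) : 0 < nu -> 0 < a -> 0 < b -> 0 <= d ->
  gain nu d a b <= coth (sigma nu d * a) * coth (sigma nu d * b).
Proof.
  intros Hnu Ha Hb Hd. unfold gain.
  pose proof (sigma_gt_0 nu d Hnu).
  assert (H1 : 1 < coth (sigma nu d * a)) by (apply coth_gt_1; nra).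
  assert (H2 : 1 < coth (sigma nu d * b)) by (apply coth_gt_1; nra).
  revert H1 H2. generalize (coth (sigma nu d * a)) (coth (sigma nu d * b)).
  intros A B H1 H2.
  assert (HD : 0 < sigma nu d + d * B) by nra.
  apply Rmult_le_compat_l; [lra|]. apply Rle_div_l; [lra|].
  assert (d * 1 <= d * (B * B)) by (apply Rmult_le_compat_l; nra). nra.
Qed.

(** Monotonicity is used only for the bound of [gain_le_coth]: [sigma] is smallest at [d = 0],
    [coth] decreases, and at [d = 0] the bound is an equality. *)
Lemma gain_le_gain_0 (nu d a b : R) : 0 < nu -> 0 < a -> 0 < b -> 0 <= d ->
  gain nu d a b <= gain nu 0 a b.
Proof.
  intros Hnu Ha Hb Hd. rewrite gain_0 by auto.
  apply Rle_trans with (1 := gain_le_coth nu d a b Hnu Ha Hb Hd).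
  rewrite <- sigma_0.
  pose proof (sigma_gt_0 nu 0 Hnu). pose proof (sigma_increasing nu d Hnu).
  assert (Hpos : forall x, 0 < x -> 0 <= coth (sigma nu d * x)).
  { intros x Hx. left. apply Rlt_trans with 1; [lra|]. apply coth_gt_1. nra. }
  apply Rmult_le_compat; auto; apply coth_decreasing; nra.
Qed.

Lemma gain_inf (nu a b eps : R) : 0 < nu -> 0 < a -> 0 < b -> 0 < eps ->
  exists d, 0 <= d /\ gain nu d a b < 1 + eps.
Proof.
  intros Hnu Ha Hb Heps.
  set (m := Rmin a b).
  assert (Hm : 0 < m) by (apply Rmin_glb_lt; auto).
  (* With [d = q / m], both [sigma * a] and [sigma * b] are at least [q], so each [coth] is at most
     [1 + 1 / q]. As [1 / q <= 1], the product is at most [1 + 3 / q], and this choice of [q] makes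
     [3 / q < eps]. *)
  set (q := 1 + 3 / eps).
  assert (H3 : 0 < 3 / eps) by (apply Rdiv_lt_0_compat; lra).
  assert (Hq : 3 / q < eps).
  { apply Rlt_div_l; [unfold q; lra|].
    replace (eps * q) with (eps + 3) by (unfold q; field; lra). lra. }
  assert (Hd : 0 < q / m) by (apply Rdiv_lt_0_compat; unfold q; lra).
  exists (q / m). split; [lra|].
  apply Rle_lt_trans with (1 := gain_le_coth nu _ a b Hnu Ha Hb (Rlt_le _ _ Hd)).
  pose proof (sigma_ge nu _ Hnu (Rlt_le _ _ Hd)) as Hs.
  assert (Hc : forall x, 0 < x -> m <= x ->
    0 <= coth (sigma nu (q / m) * x) <= 1 + / q).
  { intros x Hx Hmx.
    assert (Hqx : q <= sigma nu (q / m) * x).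
    { replace q with (q / m * m) at 1 by (field; lra).
      apply Rmult_le_compat; lra. }
    assert (Hpos : 0 < sigma nu (q / m) * x) by (unfold q in Hqx; unfold q; lra).
    split; [generalize (coth_gt_1 _ Hpos); lra|].
    apply Rle_trans with (1 := coth_le _ Hpos).
    apply Rplus_le_compat_l, Rinv_le_contravar; unfold q in *; lra. }
  destruct (Hc a Ha (Rmin_l _ _)) as [A1 A2].
  destruct (Hc b Hb (Rmin_r _ _)) as [B1 B2].
  apply Rle_lt_trans with ((1 + / q) * (1 + / q)).
  { apply Rmult_le_compat; auto. }
  assert (Hi : 0 < / q <= 1).
  { split; [apply Rinv_0_lt_compat; unfold q; lra|].
    rewrite <- Rinv_1. apply Rinv_le_contravar; unfold q; lra. }
  unfold Rdiv in Hq. nra.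
Qed.

(** * The worst factor and its minimization *)

(** The ratio is affine in the gain, so its absolute value is bounded by the values at gains 1 and
    [gain nu 0]. The latter is attained at [d = 0]; the former is reached through [gain_inf]. *)
Lemma DN2_worst_factor_max (nu T alpha theta : R) :
  0 < nu -> 0 < alpha < T -> 0 < theta ->
  DN2_worst_factor nu T alpha theta
  = Rmax (Rabs (1 - 2 * theta))
      (Rabs (1 - theta * (1 + gain nu 0 alpha (T - alpha)))).
Proof.
  intros Hnu Halpha Htheta. apply is_lub_Rbar_unique.
  assert (Hb : 0 < T - alpha) by lra.
  split.
  - intros y (d & Hd & ->). simpl. rewrite DN2_ratio_gain by auto.
    pose proof (gain_ge_1 nu d _ _ Hnu (proj1 Halpha) Hb Hd).
    pose proof (gain_le_gain_0 nu d _ _ Hnu (proj1 Halpha) Hb Hd).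
    assert (theta * 2 <= theta * (1 + gain nu d alpha (T - alpha))) by nra.
    assert (theta * (1 + gain nu d alpha (T - alpha))
      <= theta * (1 + gain nu 0 alpha (T - alpha))) by nra.
    unfold Rmax, Rabs.
    repeat (destruct Rle_dec || destruct Rcase_abs); lra.
  - intros b Hub.
    assert (H0 : Rbar_le (Rabs (1 - theta * (1 + gain nu 0 alpha (T - alpha)))) b).
    { apply Hub. exists 0. split; [lra|]. now rewrite DN2_ratio_gain by (auto; lra). }
    assert (Hd : forall d, 0 <= d ->
      Rbar_le (Rabs (1 - theta * (1 + gain nu d alpha (T - alpha)))) b).
    { intros d Hd. apply Hub. exists d. split; [lra|].
      now rewrite DN2_ratio_gain by auto. }
    (* An infinite upper bound is immediate, and minus infinity contradicts [H0]. *)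
    destruct b as [b| |]; simpl in *; [|exact I|elim H0].
    apply Rmax_lub; [|exact H0].
    apply Rnot_lt_le. intros Hlt.
    (* If [b] were below [Rabs (1 - 2 * theta)], a gain this close to 1 would change the ratio by
       less than the gap, so its absolute value would still exceed [b]. *)
    destruct (gain_inf nu alpha (T - alpha)
      ((Rabs (1 - 2 * theta) - b) / theta)) as (d & Hd0 & Hg); try lra.
    { apply Rdiv_lt_0_compat; lra. }
    specialize (Hd d Hd0).
    pose proof (gain_ge_1 nu d _ _ Hnu (proj1 Halpha) Hb Hd0).
    assert (Hg' : theta * (gain nu d alpha (T - alpha) - 1)
      < Rabs (1 - 2 * theta) - b).
    { rewrite Rmult_comm. apply Rlt_div_r; lra. }
    assert (0 <= theta * (gain nu d alpha (T - alpha) - 1)) by nra.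
    revert Hd Hg'. unfold Rabs. repeat destruct Rcase_abs; lra.
Qed.

(** The maximum dominates the decreasing line [1 - 2 * t] and the increasing line [t * (1 + C) - 1].
    It equals their common value at the crossing [ts]; elsewhere one line is strictly higher, whence
    uniqueness. *)
Lemma minmax_relaxation (C theta : R) : 1 < C ->
  (0 < theta < 1 /\
   forall theta', 0 < theta' < 1 ->
     Rmax (Rabs (1 - 2 * theta)) (Rabs (1 - theta * (1 + C)))
     <= Rmax (Rabs (1 - 2 * theta')) (Rabs (1 - theta' * (1 + C))))
  <-> theta = 2 / (3 + C).
Proof.
  intros HC.
  set (ts := 2 / (3 + C)).
  assert (Hts : ts * (3 + C) = 2) by (unfold ts; field; lra).
  assert (Hts0 : 0 < ts) by (apply Rdiv_lt_0_compat; lra).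
  assert (Hts1 : ts < 1 / 2) by nra.
  (* [ts] equalizes [1 - 2 ts] and [ts (1 + C) - 1]. *)
  assert (Eq : Rmax (Rabs (1 - 2 * ts)) (Rabs (1 - ts * (1 + C))) = 1 - 2 * ts).
  { replace (1 - ts * (1 + C)) with (- (1 - 2 * ts)) by lra.
    rewrite Rabs_Ropp, Rmax_left by lra. apply Rabs_pos_eq. lra. }
  assert (Hlow : forall t, 1 - 2 * t <= Rmax (Rabs (1 - 2 * t)) (Rabs (1 - t * (1 + C)))
    /\ t * (1 + C) - 1 <= Rmax (Rabs (1 - 2 * t)) (Rabs (1 - t * (1 + C)))).
  { intros t. split.
    - apply Rle_trans with (2 := Rmax_l _ _). apply Rle_abs.
    - apply Rle_trans with (2 := Rmax_r _ _).
      rewrite <- Rabs_Ropp. eapply Rle_trans; [|apply Rle_abs]. lra. }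
  split.
  - intros [H01 Hopt]. specialize (Hopt ts ltac:(lra)). rewrite Eq in Hopt.
    destruct (Hlow theta) as [L1 L2].
    apply Rle_antisym; nra.
  - intros ->. split; [lra|]. intros t Ht. rewrite Eq.
    destruct (Hlow t) as [L1 L2]. nra.
Qed.

Theorem theorem6 (nu T alpha : R) (Hnu : 0 < nu) (HT : 0 < T)
    (Halpha : 0 < alpha < T) :
  (forall theta : R,
     DN2_optimal nu T alpha theta <->
     theta = 2 / (3 + coth (sqrt (/ nu) * alpha)
                      * coth (sqrt (/ nu) * (T - alpha)))) /\
  2 / (3 + coth (sqrt (/ nu) * alpha) * coth (sqrt (/ nu) * (T - alpha)))
    < 1 / 2.
Proof.
  rewrite <- gain_0 by auto.
  assert (HC : 1 < gain nu 0 alpha (T - alpha)).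
  { rewrite gain_0 by auto.
    assert (Hs : 0 < sqrt (/ nu)) by now apply sqrt_lt_R0, Rinv_0_lt_compat.
    assert (1 < coth (sqrt (/ nu) * alpha)) by (apply coth_gt_1; nra).
    assert (1 < coth (sqrt (/ nu) * (T - alpha))) by (apply coth_gt_1; nra).
    nra. }
  split.
  - intros theta. rewrite <- (minmax_relaxation _ theta HC). unfold DN2_optimal.
    split; intros [H01 Hopt]; (split; [exact H01|]); intros theta' Ht;
      specialize (Hopt theta' Ht);
      rewrite !DN2_worst_factor_max in * by lra; exact Hopt.
  (* After clearing denominators this is exactly [HC]. *)
  - apply Rlt_div_l; lra.
Qed.
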